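(* Let $\{\mu_n\}_{n\geqslant0}$ be a sequence of real numbers such that $\det G_n\neq0$ for all $n\geqslant0$, where $G_n=[\mu_{i+j}]_{i,j=0}^n$. For $n\geqslant0$, let $S_n^{-1}\,H_n\,S_n^{-\top}$ be the Cholesky factorization of $G_n$ and let $\bar s_{n,0},\bar s_{n,1},\dots,\bar s_{n,n}$ denote the columns of $S_n^{\top}$. Then $\{\mu_n\}_{n\geqslant0}$ is classical if and only if there are real numbers $a,b,c$ satisfying $|a|+|b|+|c|>0$, and real numbers $a_j,b_j,c_j$, $j\geqslant0$, with $c_j\neq0$, such that the vectors $\bar s_{n,0}^{(1)},\dots,\bar s_{n,n}^{(1)}\in\mathbb{R}^{n+1}$ ($n\geqslant 0$) with $$\bar s_{n,j}^{(1)}=\frac{1}{j+1}\,N_{n+1}\,\bar s_{n+1,j+1},\quad 0\leqslant j\leqslant n,$$ satisfy, for every $n\geqslant2$, $$\Phi_{n-2}\,\bar s_{n-2,j}^{(1)}=a_j\,\bar s_{n,j+2}+b_j\,\bar s_{n,j+1}+c_j\,\bar s_{n,j},\quad 0\leqslant j\leqslant n-2.$$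
   Context: A sequence of real numbers $\{\mu_n\}_{n\geqslant 0}$ with $\mu_0\neq0$ is pre-classical if there are real numbers $a,b,c,d,e$ with $|a|+|b|+|c|>0$ and $n\,a+d\neq0$ for all $n\geqslant0$, such that $(n\,a+d)\,\mu_{n+1}+(n\,b+e)\,\mu_n+n\,c\,\mu_{n-1}=0$ for all $n\geqslant0$ (with $\mu_n=0$ for $n<0$). It is classical if moreover $\det G_n\neq0$ for all $n\geqslant0$. The Cholesky factorization $G_n=S_n^{-1}H_nS_n^{-\top}$ is the unique one with $S_n$ (equivalently $S_n^{-1}$) unit lower triangular and $H_n$ nonsingular diagonal; $S_n^{-\top}=(S_n^{-1})^{\top}$. Rows and columns are indexed from $0$. $N_{n}$, $n\geqslant 1$, is the $n\times(n+1)$ matrix with $(N_n)_{k,k+1}=k+1$ for $0\leqslant k\leqslant n-1$ and zeros elsewhere. For given $a,b,c$ and $n\geqslant0$, $\Phi_n$ is the $(n+3)\times(n+1)$ matrix whose column $j$ has entries $c$ in row $j$, $b$ in row $j+1$, $a$ in row $j+2$, and zeros elsewhere, $0\leqslant j\leqslant n$. *)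

(* Defs.v *)
From HB Require Import structures.
From mathcomp Require Import all_boot all_order all_algebra.
From mathcomp Require Import reals.

Set Implicit Arguments.
Unset Strict Implicit.
Unset Printing Implicit Defensive.

Import Order.TTheory GRing.Theory Num.Theory.

Local Open Scope ring_scope.

Definition hankel (R : realType) (mu : nat -> R) (n : nat) : 'M[R]_n.+1 :=
  \matrix_(i < n.+1, j < n.+1) mu (i + j)%N.

(* mu_{n-1}, with the convention mu_{-1} = 0 *)
Definition mu_pred (R : realType) (mu : nat -> R) (n : nat) : R :=
  if n is m.+1 then mu m else 0.

Definition preclassical (R : realType) (mu : nat -> R) : Prop :=
  mu 0%N != 0 /\
  exists a b c d e : R,
    [/\ 0 < `|a| + `|b| + `|c|,
        forall n : nat, n%:R * a + d != 0
      & forall n : nat,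
          (n%:R * a + d) * mu n.+1 + (n%:R * b + e) * mu n
          + n%:R * c * mu_pred mu n = 0].

Definition classical (R : realType) (mu : nat -> R) : Prop :=
  preclassical mu /\ forall n : nat, \det (hankel mu n) != 0.

(* [is_trig_mx] is lower triangularity in MathComp. *)
Definition unit_lower_triangular (R : realType) (n : nat) (S : 'M[R]_n) : Prop :=
  is_trig_mx S /\ forall i : 'I_n, S i i = 1.

Definition is_cholesky (R : realType) (n : nat) (G S H : 'M[R]_n) : Prop :=
  [/\ unit_lower_triangular S,
      is_diag_mx H,
      H \in unitmx
    & G = invmx S *m H *m (invmx S)^T].

(* Because of [inord], [sbar S n j] is column j of S_n^T only for j <= n. *)
Definition sbar (R : realType) (S : forall n : nat, 'M[R]_n.+1) (n j : nat)
  : 'cV[R]_n.+1 := col (inord j) (S n)^T.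

Definition Nmx (R : realType) (n : nat) : 'M[R]_(n, n.+1) :=
  \matrix_(k < n, l < n.+1) if (l == k.+1 :> nat) then k.+1%:R else 0.

Definition Phimx (R : realType) (a b c : R) (n : nat) : 'M[R]_(n.+3, n.+1) :=
  \matrix_(i < n.+3, j < n.+1)
    if (i == j :> nat) then c
    else if (i == j.+1 :> nat) then b
    else if (i == j.+2 :> nat) then a
    else 0.

Definition sbar1 (R : realType) (S : forall n : nat, 'M[R]_n.+1) (n j : nat)
  : 'cV[R]_n.+1 := (j.+1%:R)^-1 *: (Nmx R n.+1 *m sbar S n.+1 j.+1).

(* Main.v *)
Require Import Defs.
From HB Require Import structures.
From mathcomp Require Import all_boot all_order all_algebra.
From mathcomp Require Import reals.
From mathcomp Require Import ring.

Set Implicit Arguments.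
Unset Strict Implicit.
Unset Printing Implicit Defensive.

Import Order.TTheory GRing.Theory Num.Theory.

Local Open Scope ring_scope.

(** Let [L] be the linear functional on polynomials with moments [mu]. Since
    [S_n G_n S_n^T = H_n] is diagonal, the rows of [S_n] are the coefficient
    vectors of monic polynomials [P_0, ..., P_n] that are orthogonal for [L], with
    [h_k = L(P_k^2)] nonzero ([cholesky_monic_orthogonal]); such polynomials are
    unique ([monic_orthogonal_uniq]), so [P_j] does not depend on [n]. Multiplying
    a coefficient vector by [N] differentiates the polynomial, and multiplying it
    by [Phi] multiplies the polynomial by [phi = a x^2 + b x + c]. Hence the
    relation between the columns reads
    [phi P_{j+1}' / (j+1) = a_j P_{j+2} + b_j P_{j+1} + c_j P_j].

    The recurrence of the moments, on the other hand, is the Pearson equation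
    [L(phi q' + psi q) = 0] with [psi = d x + e], tested on [q = x^n]
    ([pearson_iff_recurrence]). If it holds, then applying it to [q = P_k P_{j+1}]
    gives, for [k <= j],
    [L(P_k phi P_{j+1}') = - L(P_{j+1} (phi P_k' + psi P_k))],
    where the last factor has degree at most [k + 1] and [k a + d] as coefficient
    of degree [k + 1]. The value is thus 0 for [k < j] and [- (j a + d) h_{j+1}]
    for [k = j] ([pearson_orthogonal]), so [phi P_{j+1}'], which has degree at most
    [j + 2], has a three-term expansion with [c_j] nonzero ([pearson_structure]).

    Conversely, if the three-term relation holds, then [L(phi P_k')] vanishes
    unless [k = 1], when it is [c_0 h_0]. The functional [q |-> L(phi q')]
    therefore agrees on all [P_k], hence everywhere, with [q |-> - L(psi q)] where
    [psi = - (c_0 h_0 / h_1) P_1]. The same computation of [c_j] then shows that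
    [j a + d] is nonzero ([structure_pearson]). *)

(** * Moment functionals and monic orthogonal polynomials *)

Section MomentFunctional.
Variables (F : fieldType) (mu : nat -> F).
Implicit Types (p q : {poly F}) (P Q : nat -> {poly F}).

(** The linear functional on polynomials that sends ['X^n] to [mu n]. *)
Definition moment (p : {poly F}) : F := \sum_(i < size p) p`_i * mu i.

Lemma moment_wide n p : (size p <= n)%N -> moment p = \sum_(i < n) p`_i * mu i.
Proof.
move=> le_pn; rewrite /moment (big_ord_widen n (fun i => p`_i * mu i) le_pn).
rewrite big_mkcond; apply: eq_bigr => i _.
by case: ltnP => // /(nth_default 0) ->; rewrite mul0r.
Qed.

Lemma moment_is_scalar : scalar moment.
Proof.
move=> x p q; pose n := maxn (size p) (size q).
have le_pn : (size p <= n)%N by rewrite leq_maxl.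
have le_qn : (size q <= n)%N by rewrite leq_maxr.
have le_sn : (size (x *: p + q)%R <= n)%N.
  rewrite (leq_trans (size_polyD _ _)) // geq_max le_qn andbT.
  exact: leq_trans (size_scale_leq _ _) le_pn.
rewrite (moment_wide le_pn) (moment_wide le_qn) (moment_wide le_sn).
rewrite mulr_sumr -big_split; apply: eq_bigr => i _.
by rewrite coefD coefZ mulrDl mulrA.
Qed.

HB.instance Definition _ :=
  GRing.isLinear.Build F {poly F} F *%R moment moment_is_scalar.

Lemma momentZ x p : moment (x *: p) = x * moment p.
Proof. exact: linearZ. Qed.

Lemma momentXn n : moment 'X^n = mu n.
Proof.
rewrite /moment size_polyXn big_ord_recr big1 /= => [|i _].
  by rewrite add0r coefXn eqxx mul1r.
by rewrite coefXn ltn_eqF ?mul0r.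
Qed.

(** A linear form is determined by its values on a sequence of monic polynomials
    of degrees 0, 1, 2, ... *)
Lemma scalar_eq0_on_basis (f : {poly F} -> F) P n :
    scalar f ->
    (forall k, (k < n)%N -> P k \is monic /\ size (P k) = k.+1) ->
    (forall k, (k < n)%N -> f (P k) = 0) ->
  forall q, (size q <= n)%N -> f q = 0.
Proof.
move=> f_lin; elim: n => [|n IHn] monP fP q le_qn.
  move: le_qn; rewrite size_poly_leq0 => /eqP ->.
  by have := f_lin (-1) 0 0; rewrite scaler0 add0r mulN1r addNr.
rewrite -[q](subrK (q`_n *: P n)) addrC f_lin fP // mulr0 add0r.
apply: IHn => [k lt_kn|k lt_kn|]; [exact/monP/ltnW|exact/fP/ltnW|].
have [/monicP lcP sP] := monP n (leqnn _).
apply/leq_sizeP => j; rewrite coefB coefZ leq_eqVlt => /predU1P[<-|lt_nj].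
  by move: lcP; rewrite /lead_coef sP /= => ->; rewrite mulr1 subrr.
by rewrite [q`_j]nth_default ?[(P n)`_j]nth_default ?mulr0 ?subr0 ?sP //
           (leq_trans le_qn).
Qed.

(** [P 0, ..., P N] are monic of degrees [0, ..., N], pairwise orthogonal for the
    moment functional, and each has a nonzero square norm. The values of [P] past
    [N] are irrelevant. *)
Definition monic_orthogonal (N : nat) (P : nat -> {poly F}) : Prop :=
  [/\ forall i, (i <= N)%N -> P i \is monic /\ size (P i) = i.+1,
      forall i j, (i <= N)%N -> (j <= N)%N -> i != j -> moment (P i * P j) = 0
    & forall i, (i <= N)%N -> moment (P i * P i) != 0].

Lemma moment_mulr_is_scalar p : scalar (fun q => moment (p * q)).
Proof. by move=> x u v; rewrite mulrDr -scalerAr moment_is_scalar. Qed.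

Lemma orthogonal_low_degree N P k q : monic_orthogonal N P ->
  (k <= N)%N -> (size q <= k)%N -> moment (P k * q) = 0.
Proof.
case=> monP orthP _ le_kN.
apply: (scalar_eq0_on_basis (moment_mulr_is_scalar _)) => i lt_ik.
  exact: monP (leq_trans (ltnW lt_ik) le_kN).
by rewrite orthP ?gtn_eqF // (leq_trans (ltnW lt_ik)).
Qed.

Lemma orthogonal_same_degree N P k q : monic_orthogonal N P ->
  (k <= N)%N -> (size q <= k.+1)%N ->
  moment (P k * q) = q`_k * moment (P k * P k).
Proof.
move=> opP le_kN le_qk; have [monP _ _] := opP.
have [/monicP lcP sP] := monP k le_kN.
rewrite -[q in LHS](subrK (q`_k *: P k)) mulrDr linearD /= -scalerAr momentZ.
rewrite (orthogonal_low_degree opP) ?add0r //.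
apply/leq_sizeP => j; rewrite coefB coefZ leq_eqVlt => /predU1P[<-|lt_kj].
  by move: lcP; rewrite /lead_coef sP /= => ->; rewrite mulr1 subrr.
by rewrite [q`_j]nth_default ?[(P k)`_j]nth_default ?mulr0 ?subr0 ?sP //
           (leq_trans le_qk).
Qed.

(** A polynomial of degree less than [n] that is orthogonal to [P 0, ..., P n.-1]
    vanishes: its leading coefficient, multiplied by a nonzero square norm, is one
    of these moments. *)
Lemma orthogonal_complement0 N P n p : monic_orthogonal N P ->
    (n <= N.+1)%N -> (size p <= n)%N ->
    (forall k, (k < n)%N -> moment (P k * p) = 0) ->
  p = 0.
Proof.
move=> opP le_nN le_pn orth; apply/eqP; apply: contraT => p_neq0.
have [_ _ normP] := opP.
have sp := polySpred p_neq0.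
have lt_pn : ((size p).-1 < n)%N by rewrite -sp.
have le_pN : ((size p).-1 <= N)%N by rewrite -ltnS (leq_trans lt_pn).
have /eqP := orth _ lt_pn.
rewrite (orthogonal_same_degree opP) -?sp // mulf_eq0.
by rewrite (negPf (normP _ le_pN)) orbF -lead_coefE lead_coef_eq0 (negPf p_neq0).
Qed.

Lemma monic_orthogonal_uniq N M P Q i :
    monic_orthogonal N P -> monic_orthogonal M Q ->
  (i <= N)%N -> (i <= M)%N -> P i = Q i.
Proof.
move=> opP opQ le_iN le_iM; have [monP _ _] := opP; have [monQ _ _] := opQ.
have [/monicP lcP sP] := monP i le_iN; have [/monicP lcQ sQ] := monQ i le_iM.
apply/eqP; rewrite -subr_eq0; apply/eqP.
apply: (orthogonal_complement0 (n := i) opP); first exact: leqW.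
  apply/leq_sizeP => j; rewrite coefB leq_eqVlt => /predU1P[<-|lt_ij].
    by move: lcP lcQ; rewrite /lead_coef sP sQ /= => -> ->; rewrite subrr.
  by rewrite !nth_default ?subr0 ?sQ ?sP.
move=> k lt_ki; have [_ sPk] := monP k (leq_trans (ltnW lt_ki) le_iN).
rewrite mulrC mulrBl linearB /= (orthogonal_low_degree opP) ?sPk //.
by rewrite (orthogonal_low_degree opQ) ?sPk // subr0.
Qed.

End MomentFunctional.

(** * The Pearson equation and the structure relation *)

(** The polynomial [a x^2 + b x + c]. *)
Definition phi (F : fieldType) (a b c : F) : {poly F} :=
  a *: 'X^2 + b *: 'X + c%:P.

(** The left-hand side of the Pearson equation of [moment mu], tested on [q]. Its
    vanishing for all [q] says that the distributional derivative of
    [phi * moment mu] is [(d x + e) * moment mu]. *)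
Definition pearson (F : fieldType) (mu : nat -> F) (a b c d e : F)
  (q : {poly F}) : F :=
  moment mu (phi a b c * q^`() + (d *: 'X + e%:P) * q).

Section Pearson.
Variables (F : fieldType) (mu : nat -> F).
Implicit Types (a b c d e : F) (p q : {poly F}).

Lemma mul_phiE a b c q :
  phi a b c * q = a *: (q * 'X^2) + b *: (q * 'X) + c *: q.
Proof.
by rewrite /phi !mulrDl mul_polyC -!scalerAl ![_ * q]mulrC.
Qed.

Lemma size_phi_mul a b c q : (size (phi a b c * q)%R <= (size q).+2)%N.
Proof.
apply/leq_sizeP => j le_qj; rewrite mul_phiE !coefD !coefZ coefMXn coefMX.
case: j le_qj => [|[|j]] //= le_qj.
by rewrite subSS subSS subn0 !nth_default ?mulr0 ?addr0 // ?(leqW (leqW _)) // leqW.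
Qed.

Lemma pearson_is_scalar a b c d e : scalar (pearson mu a b c d e).
Proof.
move=> x u v; rewrite /pearson -moment_is_scalar; congr moment.
rewrite linearD linearZ /= !mulrDr -!scalerAr scalerDr -!addrA; congr (_ + _).
by rewrite addrCA.
Qed.

(** The Leibniz rule splits the Pearson equation on a product. *)
Lemma pearsonM a b c d e p q :
  pearson mu a b c d e (p * q) =
    moment mu (p * (phi a b c * q^`()))
    + moment mu (q * (phi a b c * p^`() + (d *: 'X + e%:P) * p)).
Proof.
by rewrite /pearson derivM -linearD /=; congr moment; ring.
Qed.

(** The constants [k a + d] of the recurrence are the coefficients of degree
    [k + 1] of [phi p' + psi p] for [p] monic of degree [k]. *)
Lemma pearson_factor_size a b c d e p k : p \is monic -> size p = k.+1 ->
  let w := phi a b c * p^`() + (d *: 'X + e%:P) * p in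
  (size w <= k.+2)%N /\ w`_k.+1 = k%:R * a + d.
Proof.
move=> /monicP lcp sp; set w := _ + _.
have wE j : w`_j.+1 =
    (if j is i.+1 then a * (p`_j *+ j) else 0) + b * (p`_j.+1 *+ j.+1)
    + c * (p`_j.+2 *+ j.+2) + (d * p`_j + e * p`_j.+1).
  rewrite /w mul_phiE mulrDl mul_polyC -scalerAl [_ * p]mulrC.
  rewrite !coefD !coefZ coefMXn !coefMX !coef_deriv /=.
  by case: j => [|j] /=; rewrite ?mulr0 // subSS subSS subn0.
have p0 j : (k < j)%N -> p`_j = 0 by move=> lt; rewrite nth_default ?sp.
have pk : p`_k = 1 by move: lcp; rewrite /lead_coef sp.
split=> /=.
  apply/leq_sizeP => -[//|j]; rewrite ltnS => lt_kj; rewrite wE.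
  rewrite !p0 //; try by rewrite ?ltnS // ltnW // ltnS ltnW.
  by case: j lt_kj => [|j] lt_kj; rewrite ?mul0rn ?mulr0 ?addr0.
rewrite wE pk !p0 // !mul0rn !mulr0 !addr0 mulr1.
by case: (k) => [|j]; rewrite ?mul0r // mulrC.
Qed.

Lemma pearson_orthogonal a b c d e N P j k : monic_orthogonal mu N P ->
    (forall q, pearson mu a b c d e q = 0) ->
    (j.+1 <= N)%N -> (k <= j)%N ->
  moment mu (P k * (phi a b c * (P j.+1)^`())) =
    if k == j then - (j%:R * a + d) * moment mu (P j.+1 * P j.+1) else 0.
Proof.
move=> opP pear le_jN le_kj; have [monP _ _] := opP.
have [mPk sPk] := monP k (leq_trans le_kj (ltnW le_jN)).
have := pear (P k * P j.+1); rewrite pearsonM => /eqP; rewrite addr_eq0 => /eqP ->.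
have [sw cw] := pearson_factor_size a b c d e mPk sPk.
rewrite (orthogonal_same_degree opP) //; last by rewrite (leq_trans sw).
have [eq_kj|neq_kj] := eqVneq k j; first by rewrite -eq_kj cw mulNr.
rewrite nth_default ?mul0r ?oppr0 // (leq_trans sw) // ltnS.
by rewrite ltn_neqAle neq_kj.
Qed.

End Pearson.

(** On monomials, the Pearson equation is the recurrence of the moments. *)
Lemma pearsonXn (R : realType) (mu : nat -> R) a b c d e n :
  pearson mu a b c d e 'X^n =
    (n%:R * a + d) * mu n.+1 + (n%:R * b + e) * mu n + n%:R * c * mu_pred mu n.
Proof.
rewrite /pearson derivXn mul_phiE mulrDl mul_polyC -scalerAl -exprS.
rewrite !linearD /= !momentZ !momentXn.
case: n => [|n] /=.
  by rewrite mulr0n !mul0r linear0; ring.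
rewrite !mulrnAl -exprD -exprSr !linearMn /= !momentXn addn2.
by rewrite -[_ *+ n.+1]mulr_natl -![mu _ *+ _]mulr_natl; ring.
Qed.

Lemma pearson_iff_recurrence (R : realType) (mu : nat -> R) a b c d e :
  (forall q, pearson mu a b c d e q = 0) <->
  (forall n, (n%:R * a + d) * mu n.+1 + (n%:R * b + e) * mu n
             + n%:R * c * mu_pred mu n = 0).
Proof.
split=> [pear n|rec q]; first by rewrite -pearsonXn.
apply: (scalar_eq0_on_basis (P := fun k => 'X^k)
          (@pearson_is_scalar _ mu a b c d e) _ _ (leqnn (size q))) => k _.
  by rewrite monicXn size_polyXn.
by rewrite pearsonXn.
Qed.

Section StructureRelation.
Variables (R : realType) (mu : nat -> R) (P : nat -> {poly R}).
Hypothesis opP : forall N, monic_orthogonal mu N P.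

Let h k := moment mu (P k * P k).

Let h_neq0 k : h k != 0.
Proof. by have [_ _] := opP k; apply. Qed.

Let momentPP k l : moment mu (P k * P l) = if k == l then h k else 0.
Proof.
have [->//|neq_kl] := eqVneq k l.
by have [_ orthP _] := opP (maxn k l); rewrite orthP ?leq_maxl ?leq_maxr.
Qed.

Let P0 : P 0%N = 1.
Proof.
have [monP _ _] := opP 0; have [/monicP lcP sP] := monP 0%N isT.
by rewrite (size1_polyC (eq_leq sP)); move: lcP; rewrite lead_coefE sP => ->.
Qed.

Let P1 : P 1%N = 'X + ((P 1%N)`_0)%:P.
Proof.
have [monP _ _] := opP 1; have [/monicP lcP sP] := monP 1%N isT.
apply/polyP => -[|[|i]]; rewrite coefD coefX coefC /= ?add0r ?addr0 //.
  by move: lcP; rewrite lead_coefE sP.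
by rewrite nth_default ?sP.
Qed.

Let moment_relation k j x y z :
  moment mu (P k * (x *: P j.+2 + y *: P j.+1 + z *: P j)) =
    x * (if k == j.+2 then h k else 0) + y * (if k == j.+1 then h k else 0)
    + z * (if k == j then h k else 0).
Proof. by rewrite !mulrDr !linearD /= -!scalerAr !momentZ !momentPP. Qed.

Lemma pearson_structure a b c d e :
    (forall n : nat, n%:R * a + d != 0) ->
    (forall q, pearson mu a b c d e q = 0) ->
  exists a_ b_ c_ : nat -> R, (forall j, c_ j != 0) /\
    forall j, phi a b c * (j.+1%:R^-1 *: (P j.+1)^`()) =
      a_ j *: P j.+2 + b_ j *: P j.+1 + c_ j *: P j.
Proof.
move=> d_neq0 pear.
pose p j := phi a b c * (j.+1%:R^-1 *: (P j.+1)^`()).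
pose coord k j := moment mu (P k * p j) / h k.
exists (fun j => coord j.+2 j), (fun j => coord j.+1 j), (fun j => coord j j).
have low k j : (k <= j)%N -> moment mu (P k * p j) =
    j.+1%:R^-1 * (if k == j then - (j%:R * a + d) * h j.+1 else 0).
  move=> le_kj; rewrite /p -!scalerAr momentZ.
  by rewrite (pearson_orthogonal (opP j.+1) pear).
split=> j.
  rewrite /coord low // eqxx.
  by rewrite !mulf_neq0 ?invr_neq0 ?oppr_eq0 ?pnatr_eq0 ?h_neq0.
(* The difference of the two sides has degree at most j + 2 and is orthogonal to
   P_0, ..., P_{j+2}. *)
apply/eqP; rewrite -subr_eq0; apply/eqP.
have [monP _ _] := opP j.+2.
apply: (orthogonal_complement0 (n := j.+3) (opP j.+2)) => // [|k lt_kj].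
  have sP i : (i <= j.+2)%N -> (size (P i) <= j.+3)%N.
    by move=> le_ij; have [_ ->] := monP i le_ij.
  apply/leq_sizeP => i le_ji.
  rewrite coefB !coefD !coefZ.
  rewrite [(P j)`_i]nth_default ?[(P j.+1)`_i]nth_default
          ?[(P j.+2)`_i]nth_default ?(leq_trans (sP _ _)) // 1?leqW //.
  rewrite !mulr0 !addr0 subr0 nth_default //.
  apply: leq_trans (size_phi_mul _ _ _ _) _; apply: leq_trans le_ji.
  rewrite !ltnS; apply: leq_trans (size_scale_leq _ _) _.
  have [_ sP1] := monP j.+1 (leqnSn _).
  by have := lt_size_deriv (monic_neq0 (monP j.+1 (leqnSn _)).1); rewrite sP1.
rewrite mulrBr linearB /= moment_relation /coord -/(p j).
move: lt_kj; rewrite !ltnS leq_eqVlt => /predU1P[->|].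
  by rewrite eqxx !gtn_eqF // !mulr0 !addr0 divfK ?subrr.
rewrite ltnS leq_eqVlt => /predU1P[->|].
  by rewrite eqxx [_ == j]gtn_eqF // ltn_eqF // !mulr0 addr0 add0r divfK ?subrr.
rewrite ltnS => le_kj; rewrite [k == j.+2]ltn_eqF ?[k == j.+1]ltn_eqF ?ltnS // 1?leqW //.
rewrite !mulr0 !add0r.
have [->|neq_kj] := eqVneq k j; first by rewrite divfK ?subrr.
by rewrite mulr0 low // (negPf neq_kj) mulr0 subrr.
Qed.

Lemma structure_pearson a b c (a_ b_ c_ : nat -> R) :
    (forall j, c_ j != 0) ->
    (forall j, phi a b c * (j.+1%:R^-1 *: (P j.+1)^`()) =
      a_ j *: P j.+2 + b_ j *: P j.+1 + c_ j *: P j) ->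
  exists d e, (forall n : nat, n%:R * a + d != 0) /\
    forall q, pearson mu a b c d e q = 0.
Proof.
move=> c_neq0 rel.
(* psi = d x + d P_1(0) = d P_1, with d forced by the equation tested on P_1 *)
pose d := - (c_ 0%N * h 0%N / h 1%N); exists d, (d * (P 1%N)`_0).
have psiE : d *: 'X + (d * (P 1%N)`_0)%:P = d *: P 1%N.
  by rewrite [in RHS]P1 scalerDr polyCM mul_polyC.
have relk k j : moment mu (P k * (phi a b c * (P j.+1)^`())) = j.+1%:R *
    (a_ j * (if k == j.+2 then h k else 0) + b_ j * (if k == j.+1 then h k else 0)
    + c_ j * (if k == j then h k else 0)).
  rewrite -moment_relation -rel -!scalerAr momentZ [RHS]mulrA divff ?mul1r //.
  by rewrite pnatr_eq0.
have pear q : pearson mu a b c d (d * (P 1%N)`_0) q = 0.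
  apply: (scalar_eq0_on_basis (P := P)
           (@pearson_is_scalar _ mu a b c d _) _ _ (leqnn (size q))) => k _.
    by have [monP _ _] := opP k; apply: monP.
  rewrite /pearson psiE linearD /= -scalerAl momentZ momentPP.
  case: k => [|k]; first by rewrite P0 derivC mulr0 linear0 mulr0 addr0.
  rewrite -[phi _ _ _ * _]mul1r -P0 relk eqSS /= !mulr0 !add0r.
  case: k => [|k] /=; last by rewrite !mulr0 addr0.
  by rewrite mul1r /d mulNr divfK ?subrr.
split=> // n; have := relk n n.
rewrite (pearson_orthogonal (opP n.+1) pear) // eqxx !ltn_eqF // !mulr0 !add0r.
move=> eq_n; apply/eqP => d0; move/eqP: eq_n.
by rewrite d0 oppr0 mul0r eq_sym !mulf_eq0 pnatr_eq0 (negPf (c_neq0 n))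
           (negPf (h_neq0 n)).
Qed.

End StructureRelation.

(** * From coefficient vectors to polynomials *)

(** The polynomial whose coefficients, in increasing degree, are the entries of a
    column vector. *)
Definition cVpoly (F : fieldType) n (v : 'cV[F]_n) : {poly F} := rVpoly v^T.

Section CVpoly.
Variable F : fieldType.

Lemma coef_cVpoly n (v : 'cV[F]_n) (i : 'I_n) : (cVpoly v)`_i = v i 0.
Proof. by rewrite coef_rVpoly_ord mxE. Qed.

Lemma size_cVpoly n (v : 'cV[F]_n) : (size (cVpoly v) <= n)%N.
Proof. exact: size_poly. Qed.

Lemma cVpoly_inj n : injective (@cVpoly F n).
Proof. by move=> u v /(can_inj rVpolyK) /trmx_inj. Qed.

Lemma cVpolyD n (u v : 'cV[F]_n) : cVpoly (u + v) = cVpoly u + cVpoly v.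
Proof. by rewrite /cVpoly !linearD. Qed.

Lemma cVpolyZ n x (v : 'cV[F]_n) : cVpoly (x *: v) = x *: cVpoly v.
Proof. by rewrite /cVpoly !linearZ. Qed.

Lemma cVpolyE n (v : 'cV[F]_n) : cVpoly v = \sum_(i < n) v i 0 *: 'X^i.
Proof.
apply/polyP => k; rewrite coef_sum; case: (ltnP k n) => [lt_kn|le_nk].
  rewrite -[k]/(val (Ordinal lt_kn)) coef_cVpoly (bigD1 (Ordinal lt_kn)) //=.
  rewrite coefZ coefXn eqxx mulr1 big1 ?addr0 // => i ne.
  by rewrite coefZ coefXn eq_sym -val_eqE in ne *; rewrite (negPf ne) mulr0.
rewrite nth_default ?(leq_trans (size_cVpoly _)) // big1 // => i _.
by rewrite coefZ coefXn gtn_eqF ?mulr0 // (leq_trans (ltn_ord i)).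
Qed.

End CVpoly.

Section CoefficientMatrices.
Variable R : realType.

Lemma cVpoly_Nmx n (v : 'cV[R]_n.+1) : cVpoly (Nmx R n *m v) = (cVpoly v)^`().
Proof.
apply/polyP => k; rewrite coef_deriv; case: (ltnP k n) => [lt_kn|le_nk].
  rewrite -[k in LHS]/(val (Ordinal lt_kn)) coef_cVpoly mxE.
  have lt_k1 : (k.+1 < n.+1)%N by [].
  rewrite (bigD1 (Ordinal lt_k1)) //= big1 ?addr0; last first.
    by move=> i ne; rewrite mxE -val_eqE /= in ne *; rewrite (negPf ne) mul0r.
  rewrite mxE /= eqxx -[k.+1 in RHS]/(val (Ordinal lt_k1)) coef_cVpoly.
  by rewrite /= mulr_natl.
rewrite !nth_default ?mul0rn //.
  exact: leq_trans (size_cVpoly _) _.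
exact: leq_trans (size_cVpoly _) _.
Qed.

Lemma cVpoly_Phimx a b c n (v : 'cV[R]_n.+1) :
  cVpoly (Phimx a b c n *m v) = phi a b c * cVpoly v.
Proof.
rewrite 2!cVpolyE mulr_sumr.
under eq_bigr => i _ do rewrite mxE scaler_suml.
rewrite exchange_big; apply: eq_bigr => j _ /=.
rewrite -scalerAr mul_phiE -!exprD addn2 -exprSr.
under eq_bigr => i _ do rewrite mulrC -scalerA.
rewrite -scaler_sumr; congr (_ *: _).
have lt0 : (j < n.+3)%N by rewrite (ltn_trans (ltn_ord j)).
have lt1 : (j.+1 < n.+3)%N by rewrite ltnS (leq_trans (ltn_ord j)).
have lt2 : (j.+2 < n.+3)%N := ltn_ord j.
rewrite (bigD1 (Ordinal lt2)) //= (bigD1 (Ordinal lt1)) //=; last first.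
  by rewrite -val_eqE /= ltn_eqF.
rewrite (bigD1 (Ordinal lt0)) //=; last by rewrite -!val_eqE /= !ltn_eqF.
rewrite !mxE /= !eqxx !gtn_eqF //= big1 ?addr0 ?addrA //.
move=> i; rewrite -!val_eqE /= => /andP[/andP[/negPf n2 /negPf n1] /negPf n0].
by rewrite mxE n0 n1 n2 scale0r.
Qed.

(** The Hankel matrix is the Gram matrix of the monomials. *)
Lemma moment_hankel (mu : nat -> R) n (u v : 'cV[R]_n.+1) :
  moment mu (cVpoly u * cVpoly v) = (u^T *m hankel mu n *m v) 0 0.
Proof.
rewrite (cVpolyE v) mulr_sumr linear_sum mxE; apply: eq_bigr => j _ /=.
rewrite cVpolyE mulr_suml linear_sum mxE mulr_suml; apply: eq_bigr => i _ /=.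
rewrite -scalerAl -scalerAr !momentZ -exprD momentXn !mxE; ring.
Qed.

Lemma is_choleskyE n (G S H : 'M[R]_n) : is_cholesky G S H ->
  S *m G *m S^T = H.
Proof.
case=> -[trS diagS] _ _ ->.
have uS : S \in unitmx.
  by rewrite unitmxE det_trig // big1 ?unitr1.
rewrite !mulmxA mulmxV // mul1mx -mulmxA -trmx_mul mulmxV //.
by rewrite trmx1 mulmx1.
Qed.

(** The rows of the Cholesky factor are the coefficient vectors of the monic
    orthogonal polynomials. *)
Lemma cholesky_monic_orthogonal (mu : nat -> R)
    (S H : forall n : nat, 'M[R]_n.+1) n :
    is_cholesky (hankel mu n) (S n) (H n) ->
  monic_orthogonal mu n (fun i => cVpoly (sbar S n i)).
Proof.
move=> chol; have SGS := is_choleskyE chol.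
have [[trS diagS] diagH unitH _] := chol.
have coefS i (k : 'I_n.+1) : (cVpoly (sbar S n i))`_k = S n (inord i) k.
  by rewrite coef_cVpoly !mxE.
have momentS i j : moment mu (cVpoly (sbar S n i) * cVpoly (sbar S n j)) =
    H n (inord i) (inord j).
  rewrite moment_hankel /sbar -SGS tr_col trmxK -row_mul.
  rewrite !mxE; apply: eq_bigr => k _; rewrite !mxE.
  by congr (_ * _); apply: eq_bigr => l _; rewrite !mxE.
split=> [i le_in|i j le_in le_jn neq_ij|i le_in].
- have lc : (cVpoly (sbar S n i))`_i = 1.
    by rewrite -[i in _`_i](inordK (n' := n)) // coefS diagS.
  have sz : size (cVpoly (sbar S n i)) = i.+1.
    apply/eqP; rewrite eqn_leq; apply/andP; split; last first.
      by rewrite ltnNge; apply/negP => /(nth_default 0)/eqP; rewrite lc oner_eq0.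
    apply/leq_sizeP => k lt_ik; case: (ltnP k n.+1) => [lt_kn|le_nk].
      rewrite -[k]/(val (Ordinal lt_kn)) coefS.
      by apply: (is_trig_mxP trS); rewrite inordK.
    by rewrite nth_default // (leq_trans (size_cVpoly _)).
  by split=> //; rewrite monicE lead_coefE sz lc.
- rewrite momentS; apply: (is_diag_mxP diagH).
  by rewrite !inordK.
- rewrite momentS; move: unitH; rewrite unitmxE unitfE.
  have -> : \det (H n) = \prod_i H n i i by rewrite det_trig // is_diag_mx_is_trig.
  by move=> /prodf_neq0; apply.
Qed.

End CoefficientMatrices.

(* The order is written n.+2 with n >= 0, so that both sides of the structure
   relation have definitionally equal types. *)
Theorem theorem5p11 (R : realType) (mu : nat -> R)
  (S H : forall n : nat, 'M[R]_n.+1)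
  (hdet : forall n : nat, \det (hankel mu n) != 0)
  (hchol : forall n : nat, is_cholesky (hankel mu n) (S n) (H n)) :
  classical mu <->
  exists a b c : R,
    0 < `|a| + `|b| + `|c| /\
    exists a_ b_ c_ : nat -> R,
      (forall j : nat, c_ j != 0) /\
      forall n j : nat, (j <= n)%N ->
        Phimx a b c n *m sbar1 S n j =
          a_ j *: sbar S n.+2 j.+2 + b_ j *: sbar S n.+2 j.+1
          + c_ j *: sbar S n.+2 j.
Proof.
(* The j-th orthogonal polynomial, read off the last row of S_j. *)
pose P j := cVpoly (sbar S j j).
have PE n j : (j <= n)%N -> cVpoly (sbar S n j) = P j.
  move=> le_jn.
  exact: (monic_orthogonal_uniq (cholesky_monic_orthogonal (hchol n))
            (cholesky_monic_orthogonal (hchol j)) le_jn (leqnn j)).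
have opP N : monic_orthogonal mu N P.
  have [monN orthN normN] := cholesky_monic_orthogonal (hchol N).
  split=> [i le_iN|i j le_iN le_jN|i le_iN]; rewrite -?(PE N) //.
  - exact: monN.
  - exact: orthN.
  - exact: normN.
have relE a b c (a_ b_ c_ : nat -> R) n j : (j <= n)%N ->
    (Phimx a b c n *m sbar1 S n j =
       a_ j *: sbar S n.+2 j.+2 + b_ j *: sbar S n.+2 j.+1
       + c_ j *: sbar S n.+2 j) <->
    (phi a b c * (j.+1%:R^-1 *: (P j.+1)^`()) =
       a_ j *: P j.+2 + b_ j *: P j.+1 + c_ j *: P j).
  move=> le_jn; have le_j1 := leqW le_jn; have le_j2 := leqW le_j1.
  split=> [/(f_equal (@cVpoly R n.+3))|rel]; last apply: cVpoly_inj.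
    by rewrite cVpoly_Phimx !cVpolyD !cVpolyZ cVpoly_Nmx !PE.
  by rewrite cVpoly_Phimx !cVpolyD !cVpolyZ cVpoly_Nmx !PE.
split=> [[[_ [a [b [c [d [e [abc d_neq0 rec]]]]]]] _]|].
  have /pearson_iff_recurrence pear := rec.
  have [a_ [b_ [c_ [c_neq0 rel]]]] := pearson_structure opP d_neq0 pear.
  exists a, b, c; split=> //; exists a_, b_, c_; split=> // n j le_jn.
  exact/relE.
move=> [a [b [c [abc [a_ [b_ [c_ [c_neq0 rel]]]]]]]]; split=> //; split.
  (* the Hankel matrix of order 0 is the single entry mu 0 *)
  by have := hdet 0%N; rewrite det_mx11 mxE.
have relP j := (relE a b c a_ b_ c_ j j (leqnn j)).1 (rel j j (leqnn j)).
have [d [e [d_neq0 pear]]] := structure_pearson opP c_neq0 relP.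
by exists a, b, c, d, e; split=> //; apply/pearson_iff_recurrence.
Qed.
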